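(* Let $\ell:\mathbb{N}\to\mathbb{R}$ be a function with $\ell(N)=o(N^{1/2})$ as $N\to\infty$ (the values $\ell(N)$ may be negative), and let $m=m(N)$ be a positive integer valued function with $m(N)=o(N^{1/2})$ as $N\to\infty$. Then there is an absolute constant $C>0$ such that for all sufficiently large $N$ the following holds. If $\mathcal{A}\subseteq\{1,\ldots,N\}$ is a $B_2$ set with $$k=|\mathcal{A}|\ge N^{1/2}-\ell(N),$$ then, writing $\ell=\ell(N)$ and $m=m(N)$, $$\Big\| a(x)-\frac{k}{m}\Big\|_2 \le C\cdot\begin{cases} \dfrac{N^{3/8}}{m^{1/4}} & \text{if } \ell\le N^{1/4}m^{1/2},\\[2mm] \dfrac{N^{1/4}\ell^{1/2}}{m^{1/2}} & \text{otherwise.}\end{cases}$$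
   Context: A set $\mathcal{A}\subseteq\{1,\ldots,N\}$ is of type $B_2$ if all sums $a+b$ with $a\ge b$, $a,b\in\mathcal{A}$, are distinct. For a modulus $m$ and $x\in\mathbb{Z}_m$, $a(x)=a_m(x)=|\{a\in\mathcal{A}: a\equiv x \pmod m\}|$. For $f:\mathbb{Z}_m\to\mathbb{C}$, $\|f\|_2=\big(\sum_{x\in\mathbb{Z}_m}|f(x)|^2\big)^{1/2}$; here $a(x)-k/m$ denotes the function $x\mapsto a(x)-k/m$ on $\mathbb{Z}_m$. *)

(* Defs.v *)
From HB Require Import structures.
From mathcomp Require Import all_boot all_order all_algebra finmap.
From mathcomp Require Import all_classical all_reals all_analysis.
Set Implicit Arguments.
Unset Strict Implicit.
Unset Printing Implicit Defensive.
Import Order.TTheory GRing.Theory Num.Theory.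
Import numFieldNormedType.Exports.
Local Open Scope ring_scope.

Definition is_B2 (A : {fset nat}) : Prop :=
  forall a b c d : nat, a \in A -> b \in A -> c \in A -> d \in A ->
    (b <= a)%N -> (d <= c)%N -> (a + b = c + d)%N -> a = c /\ b = d.

(* The residue classes modulo m > 0 are indexed by 'I_m rather than 'Z_m,
   since 'Z_1 has two elements. *)
Definition class_count (A : {fset nat}) (m : nat) (x : 'I_m) : nat :=
  #|` [fset a in A | a == x %[mod m]]%fset|.

(* V may be R itself, or the complex numbers over R with their real-valued
   modulus (Rcomplex R). *)
Definition norm2 (R : rcfType) (V : normedZmodType R) (m : nat)
    (f : 'I_m -> V) : R :=
  Num.sqrt (\sum_(x < m) `|f x| ^+ 2).

Definition distribution_bound (R : realType) (N m : nat) (ell : R) : R :=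
  if ell <= N%:R `^ 4^-1 * m%:R `^ 2^-1
  then N%:R `^ (3 / 8) / m%:R `^ 4^-1
  else N%:R `^ 4^-1 * ell `^ 2^-1 / m%:R `^ 2^-1.

(* Main.v *)
(* Every a in A lies in exactly L = u m windows [t - L + 1, t], t < N + L.  By
   Cauchy-Schwarz, L^2 a(x)^2 is at most N + L times the sum over t of the
   squared number of elements of the class x in the t-th window.  Summing over
   x, this counts pairs of congruent elements in a common window: L k diagonal
   ones and, as a B_2 set attains each difference j m > 0 at most once, at most
   2 sum_(j < u) (L - j m) <= L u others.  Thus
   sum_x a(x)^2 <= (N + u m)(k + u) / (u m), and u ~ N^(3/4) / m^(1/2)
   balances the error terms. *)
Require Import Defs.
From HB Require Import structures.
From mathcomp Require Import all_boot all_order all_algebra finmap zify ring lra.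
From mathcomp Require Import all_classical all_reals all_analysis.
Set Implicit Arguments.
Unset Strict Implicit.
Unset Printing Implicit Defensive.
Import Order.TTheory GRing.Theory Num.Theory.
Import numFieldNormedType.Exports.
Local Open Scope classical_set_scope.
Local Open Scope ring_scope.

(** * Elementary sums and counting *)

Lemma sqrn_sum_le (n : nat) (w : 'I_n -> nat) :
  ((\sum_(i < n) w i) ^ 2 <= n * \sum_(i < n) w i ^ 2)%N.
Proof.
(* After doubling, both sides are sums over pairs [(i, j)] and compare termwise:
   [2 w_i w_j <= w_i^2 + w_j^2]. *)
rewrite -(leq_pmul2l (_ : 0 < 2)%N) //.
have -> : ((\sum_(i < n) w i) ^ 2 =
           \sum_(i < n) \sum_(j < n) w i * w j)%N.
  by rewrite expnS expn1 big_distrlr.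
have -> : (2 * (n * \sum_(i < n) w i ^ 2) =
           \sum_(i < n) \sum_(j < n) (w i ^ 2 + w j ^ 2))%N.
  under [RHS]eq_bigr do rewrite big_split /= sum_nat_const card_ord.
  by rewrite big_split /= sum_nat_const card_ord -big_distrr /= mul2n addnn.
rewrite big_distrr /=; apply: leq_sum => i _.
by rewrite big_distrr /=; apply: leq_sum => j _; exact: nat_Cauchy.
Qed.

Lemma sum_nat_interval (T x y : nat) :
  (\sum_(t < T) (x <= t < y) = minn T y - x)%N.
Proof.
elim: T => [|T IH]; first by rewrite big_ord0 min0n sub0n.
by rewrite big_ord_recr /= IH; case: (leqP x T); case: (ltnP T y) => /=; lia.
Qed.

Lemma count_le1 (T : eqType) (P : pred T) (s : seq T) :
  uniq s -> {in s &, forall x y, P x -> P y -> x = y} -> (count P s <= 1)%N.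
Proof.
elim: s => //= x s IH /andP[xs us] inj.
case: (boolP (P x)) => Px /=; last first.
  by apply: IH => // y z ys zs; apply: inj; rewrite inE (ys, zs) orbT.
rewrite -[X in (_ <= X)%N]addn0 leq_add2l leqn0 eqn0Ngt -has_count.
apply/hasPn => y ys; apply/negP => Py.
by move: xs; rewrite (inj x y) ?inE ?eqxx ?ys ?orbT.
Qed.

(** The nonzero terms are [m (u - j)] with [0 < j < u], so twice the sum is [m u (u - 1)]. *)
Lemma sum_triangle (m u : nat) :
  (2 * \sum_(j < u) (0 < j) * (u * m - j * m) <= u * m * u)%N.
Proof.
have triangle v : (2 * \sum_(i < v) (v - i) = v * v.+1)%N.
  elim: v => [|v IH]; first by rewrite big_ord0.
  by rewrite big_ord_recl /= subn0 mulnDr IH; lia.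
case: u => [|u]; first by rewrite big_ord0.
rewrite big_ord_recl mul0n add0n.
under eq_bigr do rewrite mul1n -mulnBl subSS.
by rewrite -big_distrl /= mulnA triangle; nia.
Qed.

(** * Differences in a [B_2] set *)

Lemma B2_count_diff (A : {fset nat}) (d : nat) : is_B2 A -> (0 < d)%N ->
  (\sum_(a <- A) \sum_(b <- A) (a == b + d) <= 1)%N.
Proof.
move=> A_B2 d0.
have -> : (\sum_(a <- A) \sum_(b <- A) (a == b + d) =
           count (fun p => p.1 == p.2 + d) [seq (a, b) | a <- A, b <- A])%N.
  by rewrite -sum1_count [RHS]big_mkcond big_allpairs.
apply: count_le1.
  by apply: allpairs_uniq; rewrite ?fset_uniq // => -[? ?] [? ?].
move=> _ _ /allpairsP[[a b] /= [aA bA ->]] /allpairsP[[c e] /= [cA eA ->]].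
move=> /= /eqP ab /eqP ce.
(* Equal differences become equal sums. [is_B2] wants each pair ordered; only [e <= a], [b <= c]
   survives, the other orders contradict [a = b + d], [c = e + d] with [0 < d]. *)
have sum_eq : (a + e = c + b)%N by lia.
have [ea|ae] := leqP e a; have [bc|cb] := leqP b c.
- by have [-> ->] := A_B2 _ _ _ _ aA eA cA bA ea bc sum_eq.
- by have := A_B2 _ _ _ _ aA eA bA cA ea (ltnW cb); lia.
- by have := A_B2 _ _ _ _ eA aA cA bA (ltnW ae) bc; lia.
- by have := A_B2 _ _ _ _ eA aA bA cA (ltnW ae) (ltnW cb); lia.
Qed.

(** Congruent elements [b < a] differ by some [j m] with [0 < j]. Truncated subtraction kills the
    weight unless [j < u], and each difference occurs at most once, so the triangular sum
    dominates. *)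
Lemma B2_close_pairs (A : {fset nat}) (m u : nat) : is_B2 A -> (0 < m)%N ->
  (2 * \sum_(a <- A) \sum_(b <- A)
     (a %% m == b %% m) * (b < a) * (u * m - (a - b)) <= u * m * u)%N.
Proof.
move=> A_B2 m0; apply: leq_trans (sum_triangle m u).
rewrite leq_mul2l /=.
have le a b : ((a %% m == b %% m) * (b < a) * (u * m - (a - b)) <=
    \sum_(j < u) (0 < j) * (a == b + j * m) * (u * m - j * m))%N.
  case: eqP => // ab; case: ltnP => // lt; rewrite !mul1n.
  have [close|] := ltnP (a - b) (u * m); last by move/eqP->.
  have dvd : (m %| a - b)%N by rewrite -eqn_mod_dvd ?ab // ltnW.
  have ju : ((a - b) %/ m < u)%N by rewrite ltn_divLR.
  rewrite (bigD1 (Ordinal ju)) //= divnK // subnKC ?(ltnW lt) // eqxx.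
  have -> : (0 < (a - b) %/ m)%N by rewrite divn_gt0 // dvdn_leq ?subn_gt0.
  by rewrite !mul1n leq_addr.
apply: leq_trans (_ : (\sum_(a <- A) \sum_(b <- A) \sum_(j < u)
   (0 < j) * (a == b + j * m) * (u * m - j * m) <= _)%N).
  by apply: leq_sum => a _; apply: leq_sum.
under eq_bigr do rewrite exchange_big.
rewrite exchange_big /=; apply: leq_sum => j _.
under eq_bigr do rewrite -big_distrl -big_distrr.
rewrite -big_distrl -big_distrr /= leq_mul2r; apply/orP; right.
case: (posnP j) => [|j0]; first by rewrite mul0n.
by rewrite !mul1n B2_count_diff // muln_gt0 j0.
Qed.

(** * Sliding windows and residue classes *)

Lemma sum_shift_pair (T x y L : nat) : (y <= x)%N ->
  (\sum_(t < T) (x <= t < x + L) * (y <= t < y + L) <= L - (x - y))%N.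
Proof.
move=> yx.
have -> : (\sum_(t < T) (x <= t < x + L) * (y <= t < y + L) =
           \sum_(t < T) (x <= t < y + L))%N.
  by apply: eq_bigr => t _; rewrite mulnb; congr nat_of_bool; lia.
by rewrite sum_nat_interval; lia.
Qed.

Lemma class_countE (A : {fset nat}) (m : nat) (x : 'I_m) :
  class_count A x = count (fun a => a %% m == x)%N A.
Proof.
rewrite -size_filter; apply/perm_size/uniq_perm; rewrite ?filter_uniq ?fset_uniq //.
by move=> a; rewrite mem_filter !inE andbC (modn_small (ltn_ord x)).
Qed.

Lemma sum_class_count (A : {fset nat}) (m : nat) : (0 < m)%N ->
  (\sum_(x < m) class_count A x = #|` A|)%N.
Proof.
move=> m0; under eq_bigr do rewrite class_countE -sum1_count big_mkcond.
rewrite exchange_big -sum1_size; apply: eq_bigr => a _ /=.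
rewrite (bigD1 (Ordinal (ltn_pmod a m0))) //= eqxx big1 // => x.
by rewrite -val_eqE /= eq_sym => /negbTE ->.
Qed.

Lemma B2_class_count (A : {fset nat}) (N m u : nat) :
  (forall a, a \in A -> 1 <= a <= N)%N -> is_B2 A -> (0 < m)%N -> (0 < u)%N ->
  (u * m * \sum_(x < m) class_count A x ^ 2 <= (N + u * m) * (#|` A| + u))%N.
Proof.
move=> AN A_B2 m0 u0; under eq_bigr do rewrite class_countE.
set L := (u * m)%N.
have L0 : (0 < L)%N by rewrite muln_gt0 u0.
pose w (x : 'I_m) (t : 'I_(N + L)) :=
  (\sum_(a <- A) (a %% m == x) * (a <= t < a + L))%N.
(* Since [a <= N], all [L] indices [t] in [[a, a + L)] lie below [N + L], so each element is counted
   exactly [L] times. *)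
have wE (x : 'I_m) : (L * count (fun a => a %% m == x) A = \sum_t w x t)%N.
  rewrite exchange_big /= -sum1_count [in LHS]big_mkcond big_distrr /=.
  rewrite !big_seq; apply: eq_bigr => a /AN/andP[_ aN].
  rewrite -big_distrr /= sum_nat_interval (minn_idPr _) ?leq_add2r //.
  by rewrite addKn; case: eqP; rewrite ?mul1n ?muln1 ?muln0.
rewrite -(leq_pmul2l L0).
have -> : (L * (L * \sum_(x < m) count (fun a => a %% m == x) A ^ 2) =
    \sum_(x < m) (\sum_t w x t) ^ 2)%N.
  rewrite mulnA big_distrr /=; apply: eq_bigr => x _.
  by rewrite -wE expnMn expnS expn1.
apply: leq_trans (_ : (\sum_(x < m) (N + L) * \sum_t w x t ^ 2 <= _)%N).
  by apply: leq_sum => x _; apply: sqrn_sum_le.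
rewrite -big_distrr /= mulnCA leq_mul2l; apply/orP; right.
(* Expand the squares into pairs [(a, b)]; the sum over [x] then collapses to the single class of
   [a], leaving the indicator of congruence. *)
have -> : (\sum_(x < m) \sum_t w x t ^ 2 = \sum_(a <- A) \sum_(b <- A)
    (a %% m == b %% m) * \sum_(t < N + L) (a <= t < a + L) * (b <= t < b + L))%N.
  under [LHS]eq_bigr => x _.
    under eq_bigr => t _ do rewrite expnS expn1 big_distrlr /=.
    over.
  rewrite /= exchange_big /=.
  under eq_bigr do rewrite exchange_big /=.
  rewrite exchange_big /=; apply: eq_bigr => a _.
  under eq_bigr do rewrite exchange_big /=.
  rewrite exchange_big /=; apply: eq_bigr => b _.
  rewrite big_distrr /=; apply: eq_bigr => t _.
  under eq_bigr do rewrite mulnACA.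
  rewrite -big_distrl /=; congr (_ * _)%N.
  rewrite (bigD1 (Ordinal (ltn_pmod a m0))) //= eqxx mul1n big1 ?addn0 => [|x].
    by rewrite eq_sym.
  by rewrite -val_eqE /= eq_sym => /negbTE ->.
(* [G a b] bounds the number of windows shared by congruent [b < a]. Exchanging the sums shows that
   [G a b] and [G b a] contribute equally, whence the factor 2 of [B2_close_pairs]. *)
pose G a b := ((a %% m == b %% m) * (b < a) * (L - (a - b)))%N.
apply: leq_trans (_ : (\sum_(a <- A) \sum_(b <- A)
    ((a == b) * L + (G a b + G b a)) <= _)%N).
  apply: leq_sum => a _; apply: leq_sum => b _; rewrite /G (eq_sym (b %% m)%N).
  case: (ltngtP a b) => [ab|ba|<-]; rewrite ?eqxx ?muln0 ?mul0n ?add0n ?addn0.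
  - rewrite muln1 leq_mul2l.
    under eq_bigr do rewrite mulnC.
    by rewrite sum_shift_pair ?orbT // ltnW.
  - by rewrite muln1 leq_mul2l sum_shift_pair ?orbT // ltnW.
  - by have := sum_shift_pair (N + L) L (leqnn a); rewrite subnn subn0 !mul1n.
under eq_bigr do rewrite !big_split /=.
rewrite !big_split /= [X in (_ + (_ + X))%N]exchange_big /= addnn -mul2n.
rewrite mulnDr leq_add //; last exact: B2_close_pairs.
rewrite -sum1_size big_distrr [X in (X <= _)%N]big_seq [X in (_ <= X)%N]big_seq /=.
apply: leq_sum => a aA; rewrite -big_distrl /= muln1 -[X in (_ <= X)%N]mul1n leq_mul2r.
apply/orP; right; have <- : count (pred1 a) A = 1%N by rewrite count_uniq_mem ?aA ?fset_uniq.
by rewrite -sum1_count [X in (_ <= X)%N]big_mkcond leq_sum // => b _; rewrite eq_sym.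
Qed.

(** * Optimization over the reals *)

Lemma sum_sqr_centered (R : realFieldType) (m : nat) (a : 'I_m -> R) (k : R) :
  (0 < m)%N -> \sum_(x < m) a x = k ->
  \sum_(x < m) (a x - k / m%:R) ^+ 2 = \sum_(x < m) a x ^+ 2 - k ^+ 2 / m%:R.
Proof.
move=> m0 ak; have m0R : m%:R != 0 :> R by rewrite pnatr_eq0 -lt0n.
under eq_bigr do rewrite sqrrB.
rewrite big_split sumrB /= sumr_const card_ord sumrMnl -mulr_suml ak.
by rewrite -[X in _ + X]mulr_natr -[X in _ - X]mulr_natr; field.
Qed.

(* Here N = e ^+ 8, m = p ^+ 4, l is the paper's ell and S is the sum of the
   squares of the class counts. *)
Lemma window_optimized (R : realFieldType) (e p k u l S : R) :
  1 <= p -> p <= e -> 0 <= k -> k <= 3 * e ^+ 4 ->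
  e ^+ 6 / p ^+ 2 <= u -> u <= 2 * (e ^+ 6 / p ^+ 2) ->
  l <= e ^+ 4 -> e ^+ 4 - l <= k ->
  u * p ^+ 4 * S <= (e ^+ 8 + u * p ^+ 4) * (k + u) ->
  S - k ^+ 2 / p ^+ 4 <= 8 * (e ^+ 6 / p ^+ 2) + 2 * (l * e ^+ 4 / p ^+ 4).
Proof.
move=> p1 pe k0 ke yu uy le lk hS.
have p0 : 0 < p by lra.
have e0 : 0 < e by lra.
set y := e ^+ 6 / p ^+ 2 in yu uy *.
have y0 : 0 < y by rewrite divr_gt0 ?exprn_gt0.
have u0 : 0 < u by lra.
have P0 : 0 < p ^+ 4 by rewrite exprn_gt0.
have S_le : S <= e ^+ 8 * k / (u * p ^+ 4) + e ^+ 8 / p ^+ 4 + k + u.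
  rewrite -(ler_pM2l (mulr_gt0 u0 P0)); apply: le_trans hS _.
  by rewrite le_eqVlt; apply/orP; left; apply/eqP; field; rewrite !gt_eqF.
(* The choice of [y] gives [y^2 p^4 = e^12], so this term is also of order [y]. *)
have main : e ^+ 8 * k / (u * p ^+ 4) <= 3 * y.
  rewrite ler_pdivrMr ?mulr_gt0 //.
  apply: (@le_trans _ _ (e ^+ 8 * (3 * e ^+ 4))).
    by rewrite ler_wpM2l // exprn_ge0 // ltW.
  apply: (@le_trans _ _ (3 * y * (y * p ^+ 4))).
    by rewrite le_eqVlt; apply/orP; left; apply/eqP; rewrite /y; field; lra.
  by rewrite ler_wpM2l ?ler_wpM2r // ltW // mulr_gt0.
have k_le : k <= 3 * y.
  apply: le_trans ke _; rewrite ler_wpM2l // ler_pdivlMr ?exprn_gt0 //.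
  rewrite -[6%N]/(4 + 2)%N exprD ler_wpM2l ?exprn_ge0 ?(ltW e0) //.
  by rewrite lerXn2r // nnegrE ltW.
(* As [e^4 - l] is nonnegative, squaring gives [k^2 >= (e^4 - l)^2 >= e^8 - 2 l e^4]. *)
have defect : e ^+ 8 / p ^+ 4 - k ^+ 2 / p ^+ 4 <= 2 * (l * e ^+ 4 / p ^+ 4).
  rewrite -mulrBl !mulrA ler_wpM2r ?invr_ge0 ?(ltW P0) //.
  have -> : e ^+ 8 = (e ^+ 4) ^+ 2 by rewrite -exprM.
  have : (e ^+ 4 - l) ^+ 2 <= k ^+ 2 by rewrite lerXn2r ?nnegrE; lra.
  by have := sqr_ge0 l; rewrite sqrrB; lra.
(* The constant 8 is 3 from [main], 3 from [k_le] and 2 from [u <= 2 y]. *)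
by lra.
Qed.

(** Modulus 1 has the single class [A]; with [u = N] the window inequality reads [k^2 <= 2 (k + N)].
    This gives [k^2 <= 4 N] for [k >= 4], while [k <= 3] gives 9. *)
Lemma B2_card (A : {fset nat}) (N : nat) : (0 < N)%N ->
  (forall a, a \in A -> 1 <= a <= N)%N -> is_B2 A -> (#|` A| ^ 2 <= 9 * N)%N.
Proof.
move=> N0 AN B2A; have := B2_class_count AN B2A (ltn0Sn 0) N0.
have := sum_class_count A (ltn0Sn 0).
rewrite !big_ord1 => ->; set k := #|` A|; rewrite muln1 addnn -mul2n.
rewrite (mulnC 2) -mulnA leq_pmul2l // => k_le.
have [k4|k4] := leqP 4 k; last by apply: (@leq_trans 9); nia.
have : (4 * k <= k ^ 2)%N by rewrite expnS expn1 leq_mul2r k4 orbT.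
by lia.
Qed.

Lemma powR_mul_natr (R : realType) (x a : R) (n : nat) :
  0 <= x -> x `^ (a * n%:R) = (x `^ a) ^+ n.
Proof. by move=> x0; rewrite powRrM powR_mulrn ?powR_ge0. Qed.

(** The case threshold [ell = e^2 p^2] is where [e^6 / p^2] and [ell e^4 / p^4] agree. On either
    side [S] is at most 10 times the larger one, and [10 <= 4^2]. *)
Lemma sqrt_le_distribution_bound (R : realType) (N m : nat) (ell S : R) :
  (0 < N)%N -> (0 < m)%N ->
  let e := N%:R `^ 8^-1 in let p := m%:R `^ 4^-1 in
  S <= 8 * (e ^+ 6 / p ^+ 2) + 2 * (ell * e ^+ 4 / p ^+ 4) ->
  Num.sqrt S <= 4 * distribution_bound N m ell.
Proof.
move=> N0 m0 e p hS; rewrite /distribution_bound.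
have e0 : 0 < e by rewrite powR_gt0 // ltr0n.
have p0 : 0 < p by rewrite powR_gt0 // ltr0n.
have -> : N%:R `^ 4^-1 = e ^+ 2 :> R.
  by rewrite -powR_mul_natr //; congr (_ `^ _); field.
have -> : N%:R `^ (3 / 8) = e ^+ 3 :> R.
  by rewrite -powR_mul_natr //; congr (_ `^ _); field.
have -> : m%:R `^ 2^-1 = p ^+ 2 :> R.
  by rewrite -powR_mul_natr //; congr (_ `^ _); field.
rewrite -/p; case: ifPn => [le|]; last rewrite -ltNge => lt.
  rewrite -[leRHS]ger0_norm; last by rewrite mulr_ge0 // divr_ge0 ?exprn_ge0 ?ltW.
  rewrite -sqrtr_sqr ler_wsqrtr //; apply: (le_trans hS).
  have : ell * e ^+ 4 / p ^+ 4 <= e ^+ 6 / p ^+ 2.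
    rewrite ler_pdivrMr ?exprn_gt0 //.
    apply: (@le_trans _ _ (e ^+ 2 * p ^+ 2 * e ^+ 4)).
      by rewrite ler_wpM2r // exprn_ge0 // ltW.
    by rewrite le_eqVlt; apply/orP; left; apply/eqP; field; lra.
  have -> : (4 * (e ^+ 3 / p)) ^+ 2 = 16 * (e ^+ 6 / p ^+ 2) by field; lra.
  have : 0 <= e ^+ 6 / p ^+ 2 by rewrite divr_ge0 ?exprn_ge0 ?ltW.
  by lra.
(* Here [ell] exceeds a nonnegative threshold, so its power 1/2 is a genuine square root. *)
have l0 : 0 < ell by apply: le_lt_trans lt; rewrite mulr_ge0 ?exprn_ge0 ?ltW.
rewrite powR12_sqrt ?(ltW l0) //.
rewrite -[leRHS]ger0_norm; last first.
  by rewrite mulr_ge0 // divr_ge0 ?mulr_ge0 ?sqrtr_ge0 ?exprn_ge0 ?ltW.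
rewrite -sqrtr_sqr ler_wsqrtr //; apply: (le_trans hS).
have -> : (4 * (e ^+ 2 * Num.sqrt ell / p ^+ 2)) ^+ 2 =
    16 * (ell * e ^+ 4 / p ^+ 4).
  by rewrite -[X in 16 * (X * _ / _)](sqr_sqrtr (ltW l0)); field; lra.
have : e ^+ 6 / p ^+ 2 <= ell * e ^+ 4 / p ^+ 4.
  rewrite ler_pdivlMr ?exprn_gt0 //.
  apply: (@le_trans _ _ (e ^+ 2 * p ^+ 2 * e ^+ 4)).
    by rewrite le_eqVlt; apply/orP; left; apply/eqP; field; lra.
  by rewrite ler_wpM2r ?exprn_ge0 ?ltW.
have : 0 <= e ^+ 6 / p ^+ 2 by rewrite divr_ge0 ?exprn_ge0 ?ltW.
by lra.
Qed.

Theorem theorem2 (R : realType) :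
  exists C : R, 0 < C /\
    forall (ell : nat -> R) (m : nat -> nat),
      ell =o_\oo (fun N : nat => (N%:R : R) `^ 2^-1) ->
      (forall N : nat, (0 < m N)%N) ->
      (fun N : nat => ((m N)%:R : R)) =o_\oo (fun N : nat => (N%:R : R) `^ 2^-1) ->
      \forall N \near \oo,
        forall A : {fset nat},
          (forall a : nat, a \in A -> (1 <= a <= N)%N) ->
          is_B2 A ->
          N%:R `^ 2^-1 - ell N <= (#|` A|)%:R :> R ->
          norm2 (fun x : 'I_(m N) =>
                   (class_count A x)%:R - (#|` A|)%:R / (m N)%:R : R)
          <= C * distribution_bound N (m N) (ell N).
Proof.
(* Taking 1 as the little-o constant gives [m <= N^(1/2)] and [|ell| <= N^(1/2)] eventually, that
   is, [p <= e] and [ell <= e^4] below. *)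
exists 4; split => // ell m /eqoP/(_ 1 ltr01) ell_small m_gt0 /eqoP/(_ 1 ltr01) m_small.
near=> N => A AN B2A card_ge.
have N0 : (0 < N)%N by near: N; exact: nbhs_infty_gt.
have m0 := m_gt0 N.
have : `|ell N| <= 1 * `|N%:R `^ 2^-1 : R| by near: N.
have : `|(m N)%:R : R| <= 1 * `|N%:R `^ 2^-1 : R| by near: N.
rewrite !mul1r normr_nat ger0_norm ?powR_ge0 // => mN /(le_trans (ler_norm _)) lN.
set e : R := N%:R `^ 8^-1; set p : R := (m N)%:R `^ 4^-1.
have eN : e ^+ 8 = N%:R.
  by rewrite -powR_mul_natr // mulVf ?powRr1 // pnatr_eq0.
have e4 : N%:R `^ 2^-1 = e ^+ 4.
  by rewrite -powR_mul_natr //; congr (_ `^ _); field.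
have pm : p ^+ 4 = (m N)%:R.
  by rewrite -powR_mul_natr // mulVf ?powRr1 // pnatr_eq0.
rewrite e4 in mN lN card_ge.
have p1 : 1 <= p.
  by rewrite -(powRr0 (m N)%:R) ler_powR ?invr_ge0 // ler1n.
have pe : p <= e by rewrite -(@ler_pXn2r _ 4) ?nnegrE ?powR_ge0 // pm.
have p0 : 0 < p by lra.
have e0 : 0 < e by lra.
set y := e ^+ 6 / p ^+ 2.
have y1 : 1 <= y.
  rewrite ler_pdivlMr ?exprn_gt0 // mul1r.
  apply: (@le_trans _ _ (e ^+ 2)); first by rewrite lerXn2r // nnegrE ltW.
  by rewrite ler_weXn2l //; lra.
(* The window length must be an integer multiple of [m]; as [1 <= y], the integer [trunc y + 1] lies
   in [[y, 2 y]]. *)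
have [u u0 /andP[yu uy]] : exists2 u, (0 < u)%N & y <= u%:R <= 2 * y.
  exists (Num.trunc y).+1 => //.
  have /andP[ty yt] := trunc_itv (le_trans ler01 y1).
  by rewrite (ltW yt) -[_.+1%:R]natr1; lra.
rewrite /norm2; under eq_bigr do rewrite real_normK ?num_real //.
apply: sqrt_le_distribution_bound => //.
rewrite sum_sqr_centered //; last by rewrite -natr_sum sum_class_count.
rewrite -/e -/p -pm; apply: (@window_optimized _ _ _ _ u%:R) => //.
- rewrite -(@ler_pXn2r _ 2) ?nnegrE ?mulr_ge0 ?exprn_ge0 ?(ltW e0) //.
  by rewrite exprMn -exprM eN -!natrX -natrM ler_nat B2_card.
- under eq_bigr do rewrite -natrX.
  by rewrite eN pm -natr_sum -!(natrM, natrD) ler_nat B2_class_count.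
Unshelve. all: by end_near.
Qed.
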